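(* Let $\mathcal A,\mathcal B$ be $^*$-algebras over $\mathsf C$, let $\mathfrak X$ be a $(\mathcal B$-$\mathcal A)$-equivalence bimodule, and suppose that $\mathcal B$ has an approximate identity. Then $\mathcal B\cong\mathfrak F(\mathfrak X_{\mathcal A})$ as $^*$-algebras via the left action map $\mathsf L_{\mathcal B}:\mathcal B\to\operatorname{End}_{\mathcal A}(\mathfrak X)$, $\mathsf L_{\mathcal B}(B)x=B\cdot x$.
   Context: $\mathsf R$ is an ordered ring (commutative ring with $1\ne0$ and a subset $\mathsf P$ closed under sums and products such that $\mathsf R$ is the disjoint union $-\mathsf P\cup\{0\}\cup\mathsf P$), and $\mathsf C=\mathsf R(\mathrm i)=\mathsf R\oplus\mathrm i\mathsf R$, $\mathrm i^2=-1$, with the usual conjugation. A $^*$-algebra over $\mathsf C$ is an associative (not necessarily unital) $\mathsf C$-algebra with an antilinear involution satisfying $(AB)^*=B^*A^*$. A linear $\omega:\mathcal A\to\mathsf C$ is positive if $\omega(A^*A)\ge0$ for all $A$; a Hermitian $A$ is positive ($A\ge0$) if $\omega(A)\ge0$ for all positive linear functionals $\omega$. A pre-Hilbert space over $\mathsf C$ is a $\mathsf C$-module with a Hermitian inner product (linear in the second argument), $\langle\phi,\phi\rangle\ge0$, and $\langle\phi,\phi\rangle=0\Rightarrow\phi=0$. A $^*$-representation is a $^*$-homomorphism into the adjointable endomorphisms of a pre-Hilbert space. An approximate identity of $\mathcal B$ is a family $\{\mathcal B_\alpha,E_\alpha\}_{\alpha\in I}$, $I$ directed, with $E_\alpha=E_\alpha^*\in\mathcal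 B$, $E_\alpha=E_\alpha E_\beta=E_\beta E_\alpha$ for $\alpha<\beta$, submodules $\mathcal B_\alpha\subseteq\mathcal B_\beta$ for $\alpha\le\beta$, $\bigcup_\alpha\mathcal B_\alpha=\mathcal B$, and $E_\alpha B=B=BE_\alpha$ for $B\in\mathcal B_\alpha$. A $(\mathcal B$-$\mathcal A)$-equivalence bimodule is a $\mathsf C$-module $\mathfrak X$ with commuting left $\mathcal B$- and right $\mathcal A$-actions and maps $\langle\cdot,\cdot\rangle_{\mathcal A}:\mathfrak X\times\mathfrak X\to\mathcal A$, ${}_{\mathcal B}\langle\cdot,\cdot\rangle:\mathfrak X\times\mathfrak X\to\mathcal B$ such that: E1) X1) $\langle\cdot,\cdot\rangle_{\mathcal A}$ is $\mathsf C$-linear in the second argument; X2) $\langle x,y\rangle_{\mathcal A}=\langle y,x\rangle_{\mathcal A}^*$; X3) $\langle x,y\cdot A\rangle_{\mathcal A}=\langle x,y\rangle_{\mathcal A}A$; X4) $\langle x,x\rangle_{\mathcal A}\ge0$; X5) $\langle x,B\cdot y\rangle_{\mathcal A}=\langle B^*\cdot x,y\rangle_{\mathcal A}$; X6) the $\mathsf C$-span of all $\langle x,y\rangle_{\mathcal A}$ is $\mathcal A$. E2) Y1) ${}_{\mathcal B}\langle\cdot,\cdot\rangle$ is $\mathsf C$-linear in the first argument; Y2) ${}_{\mathcal B}\langle x,y\rangle={}_{\mathcal B}\langle y,x\rangle^*$; Y3) ${}_{\mathcal B}\langle B\cdot x,y\rangle=B\,{}_{\mathcal B}\langle x,y\rangle$;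 Y4) ${}_{\mathcal B}\langle x,x\rangle\ge0$; Y5) ${}_{\mathcal B}\langle x\cdot A,y\rangle={}_{\mathcal B}\langle x,y\cdot A^*\rangle$; Y6) the $\mathsf C$-span of all ${}_{\mathcal B}\langle x,y\rangle$ is $\mathcal B$. E3) ${}_{\mathcal B}\langle x,y\rangle\cdot z=x\cdot\langle y,z\rangle_{\mathcal A}$. E4) P): for every $^*$-representation $(\mathfrak H,\pi)$ of $\mathcal A$ the form $\langle x\otimes\psi,y\otimes\phi\rangle=\langle\psi,\pi(\langle x,y\rangle_{\mathcal A})\phi\rangle$ on $\mathfrak X\otimes_{\mathcal A}\mathfrak H$ is positive semi-definite; and Q): P holds for the conjugate $(\mathcal A$-$\mathcal B)$-bimodule $\overline{\mathfrak X}$ (conjugate $\mathsf C$-module, $A\bar x=\overline{xA^*}$, $\bar xB=\overline{B^*x}$) with $\langle\bar x,\bar y\rangle_{\mathcal B}={}_{\mathcal B}\langle x,y\rangle$. Finite rank operators: for $x,y\in\mathfrak X$ let $\Theta_{x,y}(z)=x\cdot\langle y,z\rangle_{\mathcal A}$; $\mathfrak F(\mathfrak X_{\mathcal A})$ is the $\mathsf C$-span of all $\Theta_{x,y}$, $x,y\in\mathfrak X$, a subalgebra of the right $\mathcal A$-linear endomorphisms $\operatorname{End}_{\mathcal A}(\mathfrak X)$, with $^*$-involution determined by $\Theta_{x,y}^*=\Theta_{y,x}$. *)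

(* Defs.v *)
From HB Require Import structures.
From mathcomp Require Import all_boot all_order all_algebra.
From mathcomp Require Import complex.
From mathcomp Require Import boolp classical_sets functions.

Set Implicit Arguments.
Unset Strict Implicit.
Unset Printing Implicit Defensive.

Import Order.TTheory GRing.Theory Num.Theory.
Local Open Scope ring_scope.
Local Open Scope classical_set_scope.

(* The ring C = R(i) over an ordered ring R. An ordered ring is automatically *)
(* a totally ordered integral domain, i.e. a realDomainType. The library puts *)
(* a ring structure on R[i] only when R is a field, hence the alias below,    *)
(* which reuses the library's addition, multiplication and conjugation.       *)

Definition cring (R : Type) : Type := R[i].

Section CRing.
Variable R : realDomainType.
Implicit Types z w : cring R.

HB.instance Definition _ := Choice.copy (cring R) R[i].
HB.instance Definition _ := GRing.Zmodule.copy (cring R) R[i].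

Let cmul1 : left_id (Complex 1 0 : cring R) (@ComplexField.mulc R).
Proof. by move=> [a b] /=; rewrite !mul1r !mul0r subr0 addr0. Qed.

Let cmulDl : left_distributive (@ComplexField.mulc R) (@ComplexField.addc R).
Proof.
move=> [a b] [c d] [e f] /=; rewrite !mulrDl !opprD -!addrA.
by congr (Complex (_ + _) (_ + _)); rewrite addrCA.
Qed.

Let cone_neq0 : (Complex 1 0 : cring R) != 0.
Proof. by rewrite eq_complex /= oner_eq0. Qed.

HB.instance Definition _ := GRing.Zmodule_isComNzRing.Build (cring R)
  (@ComplexField.mulcA R) (@ComplexField.mulcC R) cmul1 cmulDl cone_neq0.

Definition cconj z : cring R := conjc z.

Lemma cconjK : involutive cconj.
Proof. by move=> [a b]; rewrite /cconj /= opprK. Qed.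

Let cconj_additive : zmod_morphism cconj.
Proof.
move=> [a b] [c d].
by rewrite /cconj /GRing.add /GRing.opp /= opprD.
Qed.

HB.instance Definition _ :=
  GRing.isZmodMorphism.Build (cring R) (cring R) cconj cconj_additive.

Let cconj_multiplicative : monoid_morphism cconj.
Proof.
split; first by rewrite /cconj /GRing.one /= oppr0.
move=> [a b] [c d].
by rewrite /cconj /GRing.mul /= mulrNN mulrN mulNr -opprD.
Qed.

HB.instance Definition _ :=
  GRing.isMonoidMorphism.Build (cring R) (cring R) cconj cconj_multiplicative.

(* z >= 0 in C means that z lies in R and is nonnegative there *)
Definition cnonneg z : bool := (complex.Im z == 0) && (0 <= complex.Re z).

End CRing.

Section LinearMap.
Variables (K : pzRingType) (U : lmodType K) (V : zmodType).
Variables (s : GRing.Scale.law K V) (f : U -> V).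
Hypothesis f_lin : linear_for s f.

Lemma linear_map0 : f 0 = 0.
Proof. by rewrite -[0 in LHS]subr0 (GRing.zmod_morphism_linear f_lin) subrr. Qed.

Lemma linear_mapD : {morph f : u v / u + v}.
Proof. exact: (GRing.semilinear_linear f_lin).2. Qed.

Lemma linear_mapZ : scalable_for s f.
Proof. exact: (GRing.semilinear_linear f_lin).1. Qed.

Lemma linear_map_sum (J : Type) (r : seq J) (F : J -> U) :
  f (\sum_(j <- r) F j) = \sum_(j <- r) f (F j).
Proof. exact: (big_morph f linear_mapD linear_map0). Qed.

End LinearMap.

Definition lspan (K : pzRingType) (V : lmodType K) (S : set V) : set V :=
  [set v | exists2 s : seq (K * V), (forall p, p \in s -> S p.2) &
           v = \sum_(p <- s) p.1 *: p.2].

Section Span.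
Variables (K : pzRingType) (V : lmodType K).
Implicit Types (S : set V) (f : V -> V).

Lemma lspan_gen S v : S v -> lspan S v.
Proof.
move=> Sv; exists [:: (1, v)]; last by rewrite big_seq1 scale1r.
by move=> p; rewrite inE => /eqP ->.
Qed.

Lemma lspan_lin S : lspan S 0 /\
  forall k u v, lspan S u -> lspan S v -> lspan S (k *: u + v).
Proof.
split; first by exists [::] => //; rewrite big_nil.
move=> k _ _ [s sS ->] [t tS ->].
exists ([seq (k * p.1, p.2) | p <- s] ++ t).
  move=> p; rewrite mem_cat => /orP[/mapP[q qs ->]|]; [exact: (sS _ qs)|exact: tS].
rewrite big_cat big_map scaler_sumr; congr (_ + _).
by apply: eq_bigr => p _; rewrite scalerA.
Qed.

Lemma lspan_min S (T : set V) : T 0 ->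
  (forall k u v, T u -> T v -> T (k *: u + v)) -> S `<=` T -> lspan S `<=` T.
Proof.
move=> T0 TL ST _ [s sS ->]; elim: s sS => [|p s IH] sS; first by rewrite big_nil.
rewrite big_cons; apply: TL; first by apply: ST; apply: sS; rewrite mem_head.
by apply: IH => q qs; apply: sS; rewrite inE qs orbT.
Qed.

End Span.

(* Associative algebras, not necessarily unital, unlike the library's *)

HB.mixin Record Lmodule_isNUAlgebra (K : comNzRingType) A
    of GRing.Lmodule K A := {
  amul : A -> A -> A;
  amulA : associative amul;
  amul_linr : forall a, linear (amul a);
  amul_linl : forall b, linear (amul ^~ b)
}.

#[short(type="nuAlgType")]
HB.structure Definition NUAlgebra (K : comNzRingType) :=
  {A of Lmodule_isNUAlgebra K A & GRing.Lmodule K A}.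

Notation "a ** b" := (amul a b) (at level 40, left associativity) : ring_scope.

Record is_star_involution (R : realDomainType) (A : nuAlgType (cring R))
    (st : A -> A) : Prop := {
  star_antilinear : forall c a b, st (c *: a + b) = cconj c *: st a + st b;
  star_antimult : forall a b, st (a ** b) = st b ** st a;
  star_involutive : involutive st
}.

HB.mixin Record NUAlgebra_isStarAlgebra (R : realDomainType) A
    of NUAlgebra (cring R) A := {
  star : A -> A;
  starP : is_star_involution star
}.

#[short(type="starAlgType")]
HB.structure Definition StarAlgebra (R : realDomainType) :=
  {A of NUAlgebra_isStarAlgebra R A & NUAlgebra (cring R) A}.

Section Positivity.
Variables (R : realDomainType) (A : starAlgType R).

Definition positive_functional (w : A -> cring R) : Prop :=
  scalar w /\ forall a, cnonneg (w (star a ** a)).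

Definition positive_elt (a : A) : Prop :=
  star a = a /\ forall w, positive_functional w -> cnonneg (w a).

End Positivity.

HB.mixin Record Lmodule_isPreHilbert (R : realDomainType) H
    of GRing.Lmodule (cring R) H := {
  hip : H -> H -> cring R;
  hip_linear : forall x, scalar (hip x);
  hip_conj : forall x y, hip x y = cconj (hip y x);
  hip_ge0 : forall x, cnonneg (hip x x);
  hip_definite : forall x, hip x x = 0 -> x = 0
}.

#[short(type="preHilbertType")]
HB.structure Definition PreHilbert (R : realDomainType) :=
  {H of Lmodule_isPreHilbert R H & GRing.Lmodule (cring R) H}.

(* The last clause says both that rep a is adjointable and that the           *)
(* adjoint, unique since hip is definite, is rep (star a).                    *)
Record is_star_rep (R : realDomainType) (A : starAlgType R)
    (H : preHilbertType R) (rep : A -> H -> H) : Prop := {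
  rep_endo : forall a, linear (rep a);
  rep_linear : forall h, linear (rep ^~ h);
  rep_mul : forall a b h, rep (a ** b) h = rep a (rep b h);
  rep_star : forall a h k, hip (rep a h) k = hip h (rep (star a) k)
}.

Record is_submodule (K : pzRingType) (V : lmodType K) (S : set V) : Prop := {
  submodule0 : S 0;
  submodule_lin : forall k u v, S u -> S v -> S (k *: u + v)
}.

Record is_approximate_identity (R : realDomainType) (B : starAlgType R)
    (d : Order.disp_t) (I : preorderType d) (Bs : I -> set B) (E : I -> B)
    : Prop := {
  ai_inhabited : inhabited I;
  ai_directed : forall i j : I, exists k, (i <= k)%O /\ (j <= k)%O;
  ai_hermitian : forall i, star (E i) = E i;
  ai_absorb : forall i j, (i < j)%O -> E i = E i ** E j /\ E i = E j ** E i;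
  ai_submodule : forall i, is_submodule (Bs i);
  ai_increasing : forall i j, (i <= j)%O -> Bs i `<=` Bs j;
  ai_cover : \bigcup_i Bs i = setT;
  ai_unit : forall i b, Bs i b -> E i ** b = b /\ b ** E i = b
}.

Definition has_approximate_identity (R : realDomainType) (B : starAlgType R)
    : Prop :=
  exists (d : Order.disp_t) (I : preorderType d) (Bs : I -> set B) (E : I -> B),
    is_approximate_identity Bs E.


(* B-A-bimodules, with C-bilinear actions; nothing is assumed about units. *)
HB.mixin Record Lmodule_isBimodule (R : realDomainType) (B A : starAlgType R) X
    of GRing.Lmodule (cring R) X := {
  lact : B -> X -> X;
  ract : X -> A -> X;
  lact_linear : forall b, linear (lact b);
  lact_linearl : forall x, linear (lact ^~ x);
  lactM : forall b b' x, lact (b ** b') x = lact b (lact b' x);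
  ract_linear : forall x, linear (ract x);
  ract_linearl : forall a, linear (ract ^~ a);
  ractM : forall x a a', ract x (a ** a') = ract (ract x a) a';
  lract : forall b x a, ract (lact b x) a = lact b (ract x a)
}.

#[short(type="bimodType")]
HB.structure Definition Bimodule (R : realDomainType) (B A : starAlgType R) :=
  {X of Lmodule_isBimodule R B A X & GRing.Lmodule (cring R) X}.

Notation "b *> x" := (lact b x) (at level 40, left associativity) : ring_scope.
Notation "x <* a" := (ract x a) (at level 40, left associativity) : ring_scope.

(* The tensor product of X and W over A, for a left action la of the not      *)
(* necessarily unital algebra A on a C-module W: formal sums of elementary    *)
(* tensors, i.e. finite sequences of pairs, modulo the congruence generated   *)
(* by commutativity of the formal sum, biadditivity, and C- and A-balancing.  *)

Section Tensor.
Variables (R : realDomainType) (B A : starAlgType R) (X : bimodType B A).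
Variables (W : lmodType (cring R)) (la : A -> W -> W).
Implicit Types s t u : seq (X * W).

Inductive tensor_rel : seq (X * W) -> seq (X * W) -> Prop :=
| tr_refl s : tensor_rel s s
| tr_sym s t : tensor_rel s t -> tensor_rel t s
| tr_trans s t u : tensor_rel s t -> tensor_rel t u -> tensor_rel s u
| tr_cat s s' t t' :
    tensor_rel s s' -> tensor_rel t t' -> tensor_rel (s ++ t) (s' ++ t')
| tr_comm s t : tensor_rel (s ++ t) (t ++ s)
| tr_zero w : tensor_rel [:: (0, w)] [::]
| tr_addl x x' w : tensor_rel [:: (x + x', w)] [:: (x, w); (x', w)]
| tr_addr x w w' : tensor_rel [:: (x, w + w')] [:: (x, w); (x, w')]
| tr_scale c x w : tensor_rel [:: (c *: x, w)] [:: (x, c *: w)]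
| tr_act x a w : tensor_rel [:: (x <* a, w)] [:: (x, la a w)].

Definition tensor_eqb s t : bool := `[< tensor_rel s t >].

Let tensor_eqb_refl : reflexive tensor_eqb.
Proof. by move=> s; apply/asboolP/tr_refl. Qed.
Let tensor_eqb_sym : symmetric tensor_eqb.
Proof. by move=> s t; apply/asboolP/asboolP; exact: tr_sym. Qed.
Let tensor_eqb_trans : transitive tensor_eqb.
Proof.
by move=> t s u /asboolP st /asboolP tu; apply/asboolP; exact: tr_trans tu.
Qed.

Canonical tensor_equiv :=
  EquivRel tensor_eqb tensor_eqb_refl tensor_eqb_sym tensor_eqb_trans.

Definition tensor : Type := {eq_quot tensor_equiv}%qT.
HB.instance Definition _ := Choice.on tensor.

Definition tclass s : tensor := (\pi_{eq_quot tensor_equiv} s)%qT.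
Definition trepr (t : tensor) : seq (X * W) := repr (t : {eq_quot tensor_equiv}%qT).

Lemma tclassP s t : tclass s = tclass t <-> tensor_rel s t.
Proof.
rewrite /tclass; split=> [/eqP|st]; last apply/eqP; rewrite eqmodE; first by move/asboolP.
exact/asboolP.
Qed.

Lemma treprK : cancel trepr tclass.
Proof. by move=> t; exact: reprK. Qed.

Lemma tclassK s : tensor_rel (trepr (tclass s)) s.
Proof. by apply/tclassP; rewrite treprK. Qed.

Definition tscale_seq (c : cring R) s := [seq (c *: p.1, p.2) | p <- s].

Definition tzero : tensor := tclass [::].
Definition tadd (t u : tensor) : tensor := tclass (trepr t ++ trepr u).
Definition tscale (c : cring R) (t : tensor) : tensor :=
  tclass (tscale_seq c (trepr t)).
Definition topp (t : tensor) : tensor := tscale (-1) t.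

Lemma tscale_seq_rel c s t :
  tensor_rel s t -> tensor_rel (tscale_seq c s) (tscale_seq c t).
Proof.
elim=> {s t} [s|s t _|s t u _ + _|s s' t t' _ IH _ IH'|s t|w|x x' w|x w w'|k x w|x a w].
- exact: tr_refl.
- exact: tr_sym.
- exact: tr_trans.
- by rewrite /tscale_seq !map_cat; apply: tr_cat.
- by rewrite /tscale_seq !map_cat; apply: tr_comm.
- by rewrite /= scaler0; apply: tr_zero.
- by rewrite /= scalerDr; apply: tr_addl.
- exact: tr_addr.
- by rewrite /= scalerA mulrC -scalerA; apply: tr_scale.
by rewrite /= -(linear_mapZ (ract_linearl a)); apply: tr_act.
Qed.

Let taddA : associative tadd.
Proof.
move=> t u v; apply/tclassP.
apply: (@tr_trans _ (trepr t ++ (trepr u ++ trepr v))).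
  by apply: tr_cat; [exact: tr_refl|exact: tclassK].
by rewrite catA; apply: tr_sym; apply: tr_cat; [exact: tclassK|exact: tr_refl].
Qed.

Let taddC : commutative tadd.
Proof. by move=> t u; apply/tclassP; exact: tr_comm. Qed.

Let tadd0 : left_id tzero tadd.
Proof.
move=> t; rewrite -[RHS]treprK; apply/tclassP.
by apply: (@tr_cat _ [::]); [exact: tclassK|exact: tr_refl].
Qed.

Let taddN : left_inverse tzero topp tadd.
Proof.
move=> t; apply/tclassP.
apply: (@tr_trans _ (tscale_seq (-1) (trepr t) ++ trepr t)).
  by apply: tr_cat; [exact: tclassK|exact: tr_refl].
elim: (trepr t) => [|[x w] s IH]; first exact: tr_refl.
rewrite /= scaleN1r -cat1s -[(x, w) :: s]cat1s catA.
apply: (@tr_trans _ ([:: (- x, w)] ++ ([:: (x, w)] ++ tscale_seq (-1) s) ++ s)).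
  rewrite -!catA; apply: tr_cat; first exact: tr_refl.
  by rewrite !catA; apply: tr_cat; [exact: tr_comm|exact: tr_refl].
rewrite -(catA [:: (x, w)]) (catA [:: (- x, w)]); apply: (@tr_cat _ [::] _ [::]) => //.
apply: (@tr_trans _ [:: (- x + x, w)]); first exact: tr_sym (tr_addl _ _ _).
by rewrite addNr; exact: tr_zero.
Qed.

HB.instance Definition _ := GRing.isZmodule.Build tensor taddA taddC tadd0 taddN.

Let tscaleA a b (t : tensor) : tscale a (tscale b t) = tscale (a * b) t.
Proof.
apply/tclassP; apply: tr_trans (tscale_seq_rel a (tclassK _)) _.
rewrite /tscale_seq -map_comp /comp /=.
by rewrite (eq_map (_ : _ =1 fun p => ((a * b) *: p.1, p.2)));
  [exact: tr_refl|move=> p; rewrite scalerA].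
Qed.

Let tscale1 : left_id 1 tscale.
Proof.
move=> t; rewrite -[RHS]treprK; apply/tclassP; rewrite /tscale_seq map_id_in.
  exact: tr_refl.
by move=> [x w] _; rewrite scale1r.
Qed.

Let tscaleDr : right_distributive tscale +%R.
Proof.
move=> c t u; apply/tclassP; apply: tr_trans (tscale_seq_rel c (tclassK _)) _.
by rewrite /tscale_seq map_cat; apply: tr_cat; exact: tr_sym (tclassK _).
Qed.

Let tscaleDl (t : tensor) : {morph tscale^~ t : a b / a + b}.
Proof.
move=> a b; apply/tclassP.
apply: (@tr_trans _ (tscale_seq a (trepr t) ++ tscale_seq b (trepr t))); last first.
  by apply: tr_cat; exact: tr_sym (tclassK _).
elim: (trepr t) => [|[x w] s IH]; first exact: tr_refl.
rewrite /= scalerDl -cat1s.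
apply: (@tr_trans _ ([:: (a *: x, w); (b *: x, w)] ++
                     (tscale_seq a s ++ tscale_seq b s))).
  by apply: tr_cat IH; exact: tr_addl.
set sa := tscale_seq a s; set sb := tscale_seq b s.
change (tensor_rel ([:: (a *: x, w)] ++ ([:: (b *: x, w)] ++ (sa ++ sb)))
                   ([:: (a *: x, w)] ++ (sa ++ ([:: (b *: x, w)] ++ sb)))).
apply: tr_cat; first exact: tr_refl.
by rewrite !catA; apply: tr_cat; [exact: tr_comm|exact: tr_refl].
Qed.

HB.instance Definition _ := GRing.Zmodule_isLmodule.Build (cring R) tensor
  tscaleA tscale1 tscaleDr tscaleDl.

Definition tens (x : X) (w : W) : tensor := tclass [:: (x, w)].

Lemma tclassE s : tclass s = \sum_(p <- s) tens p.1 p.2.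
Proof.
elim: s => [|[x w] s IH]; first by rewrite big_nil.
rewrite big_cons -IH; apply/tclassP; rewrite -cat1s.
by apply: tr_cat; exact: tr_sym (tclassK _).
Qed.

Lemma tens_act x a w : tens (x <* a) w = tens x (la a w).
Proof. by apply/tclassP; exact: tr_act. Qed.

Lemma tens_linearl w : linear (tens ^~ w).
Proof.
move=> c x y; apply/tclassP; apply: tr_trans (tr_addl _ _ _) _.
rewrite -cat1s; apply: tr_cat; last exact: tr_sym (tclassK _).
by apply: tr_sym; apply: tr_trans (tclassK _) _; exact: (tscale_seq_rel c (tclassK _)).
Qed.

Lemma tens_linear x : linear (tens x).
Proof.
move=> c w w'; apply/tclassP; apply: tr_trans (tr_addr _ _ _) _.
rewrite -cat1s; apply: tr_cat; last exact: tr_sym (tclassK _).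
apply: tr_sym; apply: tr_trans (tclassK _) _.
by apply: tr_trans (tscale_seq_rel c (tclassK _)) _; exact: tr_scale.
Qed.

End Tensor.

(* The form <x (x) h, y (x) k> = <h, rep <x, y>_A k> on the tensor product of *)
(* X and H over A, evaluated on representatives; rieffel_formE shows that it  *)
(* does not depend on their choice for any A-valued inner product ip.         *)

Section RieffelForm.
Variables (R : realDomainType) (B A : starAlgType R) (X : bimodType B A).
Variables (ip : X -> X -> A).
Variables (H : preHilbertType R) (rep : A -> H -> H).

Definition rieffel_seq (s t : seq (X * H)) : cring R :=
  \sum_(p <- s) \sum_(q <- t) hip p.2 (rep (ip p.1 q.1) q.2).

Definition rieffel_form (t u : tensor X rep) : cring R :=
  rieffel_seq (trepr t) (trepr u).

Hypothesis ip_linear : forall x, linear (ip x).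
Hypothesis ip_star : forall x y, ip x y = star (ip y x).
Hypothesis ip_ract : forall x y a, ip x (y <* a) = ip x y ** a.
Hypothesis repP : is_star_rep rep.

Lemma rieffel_seq_conj s t : rieffel_seq s t = cconj (rieffel_seq t s).
Proof.
rewrite /rieffel_seq exchange_big rmorph_sum; apply: eq_bigr => q _.
rewrite rmorph_sum; apply: eq_bigr => p _.
by rewrite [LHS]hip_conj (rep_star repP) -ip_star.
Qed.

Lemma rieffel_seq_relr s t t' :
  tensor_rel rep t t' -> rieffel_seq s t = rieffel_seq s t'.
Proof.
have cat2 u v : rieffel_seq s (u ++ v) = rieffel_seq s u + rieffel_seq s v.
  by rewrite /rieffel_seq -big_split; apply: eq_bigr => p _; rewrite big_cat.
elim=> {t t'} [t|t t' _|t t' u _ -> _ ->|t t' u u' _ IH _ IH'|t t'|w|x x' w|x w w'|k x w|x a w] //.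
- by rewrite !cat2 IH IH'.
- by rewrite !cat2 addrC.
- rewrite /rieffel_seq; apply: eq_bigr => p _; rewrite big_seq1 big_nil /=.
  by rewrite (linear_map0 (ip_linear _)) (linear_map0 (rep_linear repP _))
    (linear_map0 (hip_linear _)).
- rewrite /rieffel_seq; apply: eq_bigr => p _; rewrite !big_cons !big_nil !addr0 /=.
  by rewrite (linear_mapD (ip_linear _)) (linear_mapD (rep_linear repP _))
    (linear_mapD (hip_linear _)).
- rewrite /rieffel_seq; apply: eq_bigr => p _; rewrite !big_cons !big_nil !addr0 /=.
  by rewrite (linear_mapD (rep_endo repP _)) (linear_mapD (hip_linear _)).
- rewrite /rieffel_seq; apply: eq_bigr => p _; rewrite !big_seq1 /=.
  by rewrite (linear_mapZ (ip_linear _)) (linear_mapZ (rep_linear repP _))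
    (linear_mapZ (rep_endo repP _)).
- rewrite /rieffel_seq; apply: eq_bigr => p _; rewrite !big_seq1 /=.
  by rewrite ip_ract (rep_mul repP).
Qed.

Lemma rieffel_formE s t :
  rieffel_form (tclass rep s) (tclass rep t) = rieffel_seq s t.
Proof.
rewrite /rieffel_form (rieffel_seq_relr _ (tclassK _ _)) rieffel_seq_conj.
by rewrite (rieffel_seq_relr _ (tclassK _ _)) -rieffel_seq_conj.
Qed.

Lemma rieffel_form_tens x y h k :
  rieffel_form (tens rep x h) (tens rep y k) = hip h (rep (ip x y) k).
Proof. by rewrite rieffel_formE /rieffel_seq !big_seq1. Qed.

End RieffelForm.

Definition rieffel_positive (R : realDomainType) (B A : starAlgType R)
    (X : bimodType B A) (ip : X -> X -> A) : Prop :=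
  forall (H : preHilbertType R) (rep : A -> H -> H), is_star_rep rep ->
    forall t : tensor X rep, cnonneg (rieffel_form ip t t).

(* The conjugate (A-B)-bimodule of a (B-A)-bimodule X; cbar x is x-bar. *)

Definition conjmod (X : Type) : Type := X.
Definition cbar (X : Type) (x : X) : conjmod X := x.
Definition cunbar (X : Type) (x : conjmod X) : X := x.

HB.instance Definition _ (X : zmodType) := GRing.Zmodule.copy (conjmod X) X.

Section ConjugateModule.
Variables (R : realDomainType) (X : lmodType (cring R)).

Definition conj_scale (c : cring R) (x : conjmod X) : conjmod X :=
  cbar (cconj c *: cunbar x).

Let conj_scaleA a b x : conj_scale a (conj_scale b x) = conj_scale (a * b) x.
Proof. by rewrite /conj_scale rmorphM -scalerA. Qed.
Let conj_scale1 : left_id 1 conj_scale.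
Proof. by move=> x; rewrite /conj_scale rmorph1 [LHS]scale1r. Qed.
Let conj_scaleDr : right_distributive conj_scale +%R.
Proof. by move=> c x y; exact: scalerDr. Qed.
Let conj_scaleDl x : {morph conj_scale^~ x : a b / a + b}.
Proof. by move=> a b; rewrite /conj_scale rmorphD; exact: scalerDl. Qed.

HB.instance Definition _ := GRing.Zmodule_isLmodule.Build (cring R) (conjmod X)
  conj_scaleA conj_scale1 conj_scaleDr conj_scaleDl.

End ConjugateModule.

Section ConjugateBimodule.
Variables (R : realDomainType) (B A : starAlgType R) (X : bimodType B A).

Definition conj_lact (a : A) (x : conjmod X) : conjmod X :=
  cbar (cunbar x <* star a).
Definition conj_ract (x : conjmod X) (b : B) : conjmod X :=
  cbar (star b *> cunbar x).

Let conj_lact_linear a : linear (conj_lact a).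
Proof. by move=> c x y; exact: ract_linearl. Qed.
Let conj_lact_linearl x : linear (conj_lact ^~ x).
Proof.
move=> c a a'; rewrite /conj_lact (star_antilinear starP).
exact: ract_linear.
Qed.
Let conj_lactM a a' x : conj_lact (a ** a') x = conj_lact a (conj_lact a' x).
Proof. by rewrite /conj_lact (star_antimult starP); exact: ractM. Qed.
Let conj_ract_linear x : linear (conj_ract x).
Proof.
move=> c b b'; rewrite /conj_ract (star_antilinear starP).
exact: lact_linearl.
Qed.
Let conj_ract_linearl b : linear (conj_ract ^~ b).
Proof. by move=> c x y; exact: lact_linear. Qed.
Let conj_ractM x b b' : conj_ract x (b ** b') = conj_ract (conj_ract x b) b'.
Proof. by rewrite /conj_ract (star_antimult starP); exact: lactM. Qed.
Let conj_lract a x b : conj_ract (conj_lact a x) b = conj_lact a (conj_ract x b).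
Proof. by symmetry; exact: lract. Qed.

HB.instance Definition _ := Lmodule_isBimodule.Build R A B (conjmod X)
  conj_lact_linear conj_lact_linearl conj_lactM
  conj_ract_linear conj_ract_linearl conj_ractM conj_lract.

End ConjugateBimodule.

Record is_right_inner (R : realDomainType) (B A : starAlgType R)
    (X : bimodType B A) (ip : X -> X -> A) : Prop := {
  rip_linear : forall x, linear (ip x);
  rip_star : forall x y, ip x y = star (ip y x);
  rip_ract : forall x y a, ip x (y <* a) = ip x y ** a;
  rip_ge0 : forall x, positive_elt (ip x x);
  rip_lact : forall x y b, ip x (b *> y) = ip (star b *> x) y;
  rip_full : lspan [set a | exists x y, a = ip x y] = setT
}.

Record is_left_inner (R : realDomainType) (B A : starAlgType R)
    (X : bimodType B A) (ip : X -> X -> B) : Prop := {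
  lip_linear : forall y, linear (ip ^~ y);
  lip_star : forall x y, ip x y = star (ip y x);
  lip_lact : forall x y b, ip (b *> x) y = b ** ip x y;
  lip_ge0 : forall x, positive_elt (ip x x);
  lip_ract : forall x y a, ip (x <* a) y = ip x (y <* star a);
  lip_full : lspan [set b | exists x y, b = ip x y] = setT
}.

HB.mixin Record Bimodule_isEquivalence (R : realDomainType)
    (B A : starAlgType R) X of Bimodule R B A X := {
  ipA : X -> X -> A;
  ipB : X -> X -> B;
  ipA_inner : is_right_inner ipA;
  ipB_inner : is_left_inner ipB;
  ip_compat : forall x y z, ipB x y *> z = x <* ipA y z;
  ipA_positive : rieffel_positive ipA;
  ipB_positive :
    rieffel_positive (fun x y : conjmod X => ipB (cunbar x) (cunbar y))
}.

#[short(type="equivBimodType")]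
HB.structure Definition EquivalenceBimodule (R : realDomainType)
    (B A : starAlgType R) :=
  {X of Bimodule_isEquivalence R B A X & Bimodule R B A X}.

(* rend X is End_A(X), with composition as product *)

Section RightEndomorphisms.
Variables (R : realDomainType) (B A : starAlgType R) (X : bimodType B A).

Definition right_linear (f : X -> X) : bool :=
  `[< linear f /\ forall x a, f (x <* a) = f x <* a >].

Let right_linear_submod : GRing.submod_closed right_linear.
Proof.
have E c (f g : X -> X) z : (c *: f + g) z = c *: f z + g z by [].
split=> [|c f g /asboolP[fl fa] /asboolP[gl ga]]; apply/asboolP; split.
- by move=> c x y /=; rewrite scaler0 addr0.
- by move=> x a /=; rewrite (linear_map0 (ract_linearl a)).
- move=> k x y; rewrite !E fl gl !scalerDr !scalerA addrACA.
  by rewrite [c * k]mulrC.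
- by move=> x a; rewrite !E fa ga ract_linearl.
Qed.

HB.instance Definition _ := GRing.isSubmodClosed.Build (cring R) (X -> X)
  right_linear right_linear_submod.

Record rend := RightEnd { rend_fun :> X -> X; _ : right_linear rend_fun }.

HB.instance Definition _ := [isSub for rend_fun].
HB.instance Definition _ := [Choice of rend by <:].
HB.instance Definition _ := [SubChoice_isSubLmodule of rend by <:].

Lemma rendP (f : rend) : linear f /\ forall x a, f (x <* a) = f x <* a.
Proof. by case: f => f /= /asboolP. Qed.

Lemma rend_eqP (f g : rend) : f =1 g <-> f = g.
Proof.
by split=> [fg|->//]; apply: val_inj => /=; apply/funext.
Qed.

Lemma rend_comp_subproof (f g : rend) : right_linear (f \o g).
Proof.
have [[fl fa] [gl ga]] := (rendP f, rendP g).
by apply/asboolP; split=> [c x y|x a] /=; rewrite ?gl ?fl // ga fa.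
Qed.

Definition rend_comp (f g : rend) : rend := RightEnd (rend_comp_subproof f g).

Let rend_compA : associative rend_comp.
Proof. by move=> f g h; apply/rend_eqP. Qed.
Let rend_comp_linr f : linear (rend_comp f).
Proof. by move=> c g h; apply/rend_eqP => x /=; rewrite (rendP f).1. Qed.
Let rend_comp_linl g : linear (rend_comp ^~ g).
Proof. by move=> c f h; apply/rend_eqP. Qed.

HB.instance Definition _ := Lmodule_isNUAlgebra.Build (cring R) rend
  rend_compA rend_comp_linr rend_comp_linl.

Lemma left_action_subproof (b : B) : right_linear (lact b).
Proof. by apply/asboolP; split=> [|x a]; [exact: lact_linear|rewrite lract]. Qed.

Definition left_action (b : B) : rend := RightEnd (left_action_subproof b).

End RightEndomorphisms.

(* finrank X is F(X_A), as a subalgebra of End_A(X) *)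

Section FiniteRank.
Variables (R : realDomainType) (B A : starAlgType R) (X : equivBimodType B A).

Lemma Theta_subproof (x y : X) : right_linear (fun z : X => x <* ipA y z).
Proof.
apply/asboolP; split=> [c u v|z a].
  by rewrite (rip_linear ipA_inner) ract_linear.
by rewrite (rip_ract ipA_inner) ractM.
Qed.

Definition Theta (x y : X) : rend X := RightEnd (Theta_subproof x y).

Definition finite_rank (f : rend X) : bool :=
  `[< lspan [set g | exists x y, g = Theta x y] f >].

Let finite_rank_submod : GRing.submod_closed finite_rank.
Proof.
split=> [|c f g /asboolP ff /asboolP gf]; apply/asboolP; first exact: (lspan_lin _).1.
exact: (lspan_lin _).2.
Qed.

HB.instance Definition _ := GRing.isSubmodClosed.Build (cring R) (rend X)
  finite_rank finite_rank_submod.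

Record finrank := FinRank { finrank_op :> rend X; _ : finite_rank finrank_op }.

HB.instance Definition _ := [isSub for finrank_op].
HB.instance Definition _ := [Choice of finrank by <:].
HB.instance Definition _ := [SubChoice_isSubLmodule of finrank by <:].

Lemma finrankP (f : finrank) : lspan [set g | exists x y, g = Theta x y] (f : rend X).
Proof. by case: f => f /= /asboolP. Qed.

Lemma rend_Theta (f : rend X) x y : f ** Theta x y = Theta (f x) y.
Proof. by apply/rend_eqP => z /=; rewrite (rendP f).2. Qed.

Lemma finrank_mul_subproof (f g : finrank) : finite_rank ((f : rend X) ** g).
Proof.
apply/asboolP.
pose T : set (rend X) :=
  [set h | lspan [set g | exists x y, g = Theta x y] ((f : rend X) ** h)].
apply: (lspan_min (T := T)) (finrankP g); rewrite /T.
- by rewrite /= (linear_map0 (amul_linr _)); exact: (lspan_lin _).1.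
- by move=> k u v /= Tu Tv; rewrite amul_linr; exact: (lspan_lin _).2.
by move=> _ [x [y ->]] /=; rewrite rend_Theta; apply: lspan_gen; exists (f x), y.
Qed.

Definition finrank_mul (f g : finrank) : finrank :=
  FinRank (finrank_mul_subproof f g).

Let finrank_mulA : associative finrank_mul.
Proof. by move=> f g h; apply: val_inj; exact: amulA. Qed.
Let finrank_mul_linr f : linear (finrank_mul f).
Proof. by move=> c g h; apply: val_inj; exact: amul_linr. Qed.
Let finrank_mul_linl g : linear (finrank_mul ^~ g).
Proof. by move=> c f h; apply: val_inj; exact: amul_linl. Qed.

HB.instance Definition _ := Lmodule_isNUAlgebra.Build (cring R) finrank
  finrank_mulA finrank_mul_linr finrank_mul_linl.

Lemma finrank_Theta_subproof x y : finite_rank (Theta x y).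
Proof. by apply/asboolP/lspan_gen; exists x, y. Qed.

Definition finrank_Theta (x y : X) : finrank := FinRank (finrank_Theta_subproof x y).

(* The rule Theta x y |-> Theta y x determines at most one involution (see    *)
(* finrank_involution_uniq), but it need not be well defined on the span of   *)
(* the Theta x y without further assumptions, so it is kept as a predicate.   *)
Definition is_finrank_involution (st : finrank -> finrank) : Prop :=
  is_star_involution st /\
  forall x y, st (finrank_Theta x y) = finrank_Theta y x.

Lemma finrank_involution_uniq st st' :
  is_finrank_involution st -> is_finrank_involution st' -> st =1 st'.
Proof.
move=> [stI stT] [stI' stT'] f.
have st0 s : is_star_involution s -> s 0 = 0 :> finrank.
  move=> sI; have := star_antilinear sI (-1) 0 0.
  by rewrite scaler0 addr0 rmorphN1 scaleN1r addNr.
pose T : set (rend X) := [set h | exists2 h' : finrank, val h' = h & st h' = st' h'].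
have [f' /val_inj <- //] : T (val f).
apply: (lspan_min (T := T)) (finrankP f).
- by exists 0; rewrite // !st0.
- move=> c _ _ [u <- uE] [v <- vE]; exists (c *: u + v) => //.
  by rewrite (star_antilinear stI) (star_antilinear stI') uE vE.
move=> _ [x [y ->]]; exists (finrank_Theta x y) => //.
by rewrite stT stT'.
Qed.

End FiniteRank.

Definition is_star_isomorphism (K : realDomainType) (A A' : nuAlgType (cring K))
    (st : A -> A) (st' : A' -> A') (f : A -> A') : Prop :=
  [/\ linear f, bijective f, {morph f : a b / a ** b} &
      forall a, f (st a) = st' (f a)].

(* Main.v *)
(* The left action sends ipB x y to Theta x y (axiom E3), so by fullness it   *)
(* maps B onto the span of the Theta x y, and the involution of B carries     *)
(* Theta x y to Theta y x.  It is injective because b *> x = 0 for all x      *)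
(* forces b ** ipB x y = 0, hence b ** B = 0 by fullness, while b = b ** E i  *)
(* for some member E i of the approximate identity.                           *)
Require Import Defs.
From mathcomp Require Import all_boot all_order all_algebra.
From mathcomp Require Import boolp classical_sets.

Set Implicit Arguments.
Unset Strict Implicit.
Unset Printing Implicit Defensive.

Import GRing.Theory.
Local Open Scope ring_scope.

(** Compatibility of the inner products turns the action of [ipB x y] into [Theta x y], so fullness
    of [ipB] makes the image exactly the finite rank operators. Elements acting alike have equal
    products with every [ipB x y], hence with all of [B], and the approximate identity separates
    them. The involution on [finrank X] is [star] carried across this bijection, so that [Theta x y]
    going to [Theta y x] is well defined comes for free. *)

Lemma approximate_identity_faithful (R : realDomainType) (B : starAlgType R)
    (b : B) :
  has_approximate_identity B -> (forall c, b ** c = 0) -> b = 0.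
Proof.
move=> [d [I [Bs [E aiB]]]] b0.
(* Some [Bs i] contains [b], so [b] equals [b ** E i], a product that vanishes by hypothesis. *)
have [i _ /(ai_unit aiB)[_ <-]] : (\bigcup_i Bs i)%classic b.
  by rewrite (ai_cover aiB).
exact: b0.
Qed.

Section LeftAction.
Variables (R : realDomainType) (A B : starAlgType R) (X : equivBimodType B A).

Lemma left_action_linear : linear (left_action X : B -> rend X).
Proof. by move=> c a b; apply/rend_eqP => x; exact: lact_linearl. Qed.

Lemma left_actionM (a b : B) :
  left_action X (a ** b) = left_action X a ** left_action X b.
Proof. by apply/rend_eqP => x; exact: lactM. Qed.

Lemma left_action_ipB (x y : X) : left_action X (ipB x y) = Theta x y.
Proof. by apply/rend_eqP => z; exact: ip_compat. Qed.

(** Fullness of [ipB] recast as an induction principle; it serves both the finite rank property and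
    injectivity. *)
Lemma left_inner_ind (P : B -> Prop) :
  P 0 -> (forall c a b, P a -> P b -> P (c *: a + b)) ->
  (forall x y : X, P (ipB x y)) -> forall b, P b.
Proof.
move=> P0 PL Pip b.
apply: (lspan_min (S := [set b | exists x y : X, b = ipB x y]%classic) P0 PL).
  by move=> _ [x [y ->]]; exact: Pip.
by rewrite (lip_full ipB_inner).
Qed.

Lemma left_action_finite_rank (b : B) : finite_rank (left_action X b).
Proof.
apply/asboolP; move: b; apply: left_inner_ind => [|c a b Pa Pb|x y].
- by rewrite (linear_map0 left_action_linear); exact: (lspan_lin _).1.
- by rewrite left_action_linear; exact: (lspan_lin _).2.
by rewrite left_action_ipB; apply: lspan_gen; exists x, y.
Qed.

Definition finrank_left_action (b : B) : finrank X :=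
  FinRank (left_action_finite_rank b).

Lemma finrank_left_action_linear : linear finrank_left_action.
Proof. by move=> c a b; apply: val_inj; exact: left_action_linear. Qed.

Lemma finrank_left_actionM :
  {morph finrank_left_action : a b / a ** b}.
Proof. by move=> a b; apply: val_inj; exact: left_actionM. Qed.

Lemma finrank_left_action_ipB (x y : X) :
  finrank_left_action (ipB x y) = finrank_Theta x y.
Proof. by apply: val_inj; exact: left_action_ipB. Qed.

Lemma finrank_left_action_surj (f : finrank X) :
  exists b, finrank_left_action b = f.
Proof.
suff [b bE] : exists b, left_action X b = f by exists b; apply: val_inj.
apply: (lspan_min (T := fun g : rend X => exists b, left_action X b = g))
  (finrankP f) => [|c _ _ [a <-] [b <-]|_ [x [y ->]]].
- by exists 0; rewrite (linear_map0 left_action_linear).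
- by exists (c *: a + b); rewrite left_action_linear.
by exists (ipB x y); rewrite left_action_ipB.
Qed.

Lemma finrank_left_action_inj :
  has_approximate_identity B -> injective finrank_left_action.
Proof.
move=> hB a b /(congr1 (fun f : finrank X => finrank_op f)) /rend_eqP ab.
apply/eqP; rewrite -subr_eq0; apply/eqP.
have D c : (a - b) ** c = a ** c - b ** c.
  by rewrite -scaleN1r addrC amul_linl scaleN1r addrC.
apply: (approximate_identity_faithful hB).
apply: left_inner_ind => [|k c c' Pc Pc'|x y].
- exact: linear_map0 (amul_linr _).
- by rewrite amul_linr Pc Pc' scaler0 addr0.
(* Left linearity of [ipB] moves [a] and [b] inside, onto [x], where their actions agree. *)
rewrite D -!(lip_lact ipB_inner).
by have /= -> := ab x; rewrite subrr.
Qed.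

End LeftAction.

Lemma star_involution_transport (R : realDomainType) (A : starAlgType R)
    (A' : nuAlgType (cring R)) (f : A -> A') (g : A' -> A) :
  linear f -> {morph f : a b / a ** b} -> cancel f g -> cancel g f ->
  is_star_involution (fun a' => f (star (g a'))).
Proof.
move=> fL fM fK gK; split=> [c a b|a b|a].
(* The inverse inherits linearity, and below multiplicativity, from [f] by injectivity. *)
- have -> : g (c *: a + b) = c *: g a + g b.
    by apply: (can_inj fK); rewrite fL !gK.
  by rewrite (star_antilinear starP) fL.
- have -> : g (a ** b) = g a ** g b by apply: (can_inj fK); rewrite fM !gK.
  by rewrite (star_antimult starP) fM.
by rewrite fK (star_involutive starP) gK.
Qed.

Theorem proposition6p1 (R : realDomainType) (A B : starAlgType R)
    (X : equivBimodType B A) (hB : has_approximate_identity B) :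
  exists (st : finrank X -> finrank X) (L : B -> finrank X),
    [/\ is_finrank_involution st,
        forall b, finrank_op (L b) = left_action X b
      & is_star_isomorphism star st L].
Proof.
pose L := @finrank_left_action _ _ _ X.
have [g gK] := choice (@finrank_left_action_surj _ _ _ X).
have LK : cancel L g.
  by move=> b; apply: (@finrank_left_action_inj _ _ _ X hB); rewrite gK.
exists (fun f => L (star (g f))), L; split=> //.
  split; first exact: star_involution_transport
    (@finrank_left_action_linear _ _ _ X) (@finrank_left_actionM _ _ _ X) LK gK.
  (* The preimage of [Theta x y] is [ipB x y], whose star is [ipB y x]. *)
  move=> x y; rewrite -finrank_left_action_ipB LK -(lip_star ipB_inner).
  exact: finrank_left_action_ipB.
split=> [||| b]; last by rewrite LK.
- exact: finrank_left_action_linear.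
- by exists g.
exact: finrank_left_actionM.
Qed.
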